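(* Let $\mathcal{E}$ be a Boolean (elementary) topos. Then every object $X\in\mathcal{E}_\star$ admits the identity $\mathrm{id}_X\colon X\to X$ as initial normal cover.
   Context: $\mathcal{E}_\star$ denotes the category of pointed objects of $\mathcal{E}$: objects are pairs $(A,\star\colon \mathbf{1}\to A)$ and morphisms preserve base points; $\mathbf{1}$ is its zero object. A normal epimorphism is a morphism of $\mathcal{E}_\star$ that is a cokernel (in $\mathcal{E}_\star$) of some morphism (equivalently, of its kernel). Initial normal cover: for $X\in\mathcal{E}_\star$, let $\mathcal{N}/X$ be the full subcategory of the slice category $\mathcal{E}_\star/X$ whose objects are the normal epimorphisms with codomain $X$. The object $X$ admits an initial normal cover when $\mathcal{N}/X$ has an initial object; this initial object is then called the initial normal cover of $X$. *)

(* Defs.v *)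
From Stdlib Require Import ProofIrrelevance.

Set Implicit Arguments.
Unset Strict Implicit.

Declare Scope cat_scope.
Open Scope cat_scope.

Record category := Category {
  Ob :> Type;
  Hom : Ob -> Ob -> Type;
  idm : forall A, Hom A A;
  comp : forall A B C, Hom B C -> Hom A B -> Hom A C;
  comp_idl : forall A B (f : Hom A B), comp (idm B) f = f;
  comp_idr : forall A B (f : Hom A B), comp f (idm A) = f;
  comp_assoc : forall A B C D (h : Hom C D) (g : Hom B C) (f : Hom A B),
    comp h (comp g f) = comp (comp h g) f
}.

Arguments Hom {c} A B.
Arguments idm {c} A.
Notation "g 'o' f" := (comp g f) (at level 40, left associativity) : cat_scope.

Section Universal.
Context {C : category}.

Definition monic {A B : C} (m : Hom A B) : Prop :=
  forall (T : C) (f g : Hom T A), m o f = m o g -> f = g.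

Definition is_initial (I : C) : Prop :=
  forall A : C, exists f : Hom I A, forall g : Hom I A, g = f.

Definition is_terminal (T : C) : Prop :=
  forall A : C, exists f : Hom A T, forall g : Hom A T, g = f.

Definition is_product (A B P : C) (p : Hom P A) (q : Hom P B) : Prop :=
  forall (T : C) (f : Hom T A) (g : Hom T B),
    exists! h : Hom T P, p o h = f /\ q o h = g.

Definition is_equalizer (A B : C) (f g : Hom A B) (E : C) (e : Hom E A) : Prop :=
  f o e = g o e /\
  forall (T : C) (h : Hom T A), f o h = g o h -> exists! k : Hom T E, e o k = h.

Definition is_pullback (A B D P : C) (f : Hom A D) (g : Hom B D)
    (p : Hom P A) (q : Hom P B) : Prop :=
  f o p = g o q /\
  forall (T : C) (u : Hom T A) (v : Hom T B), f o u = g o v ->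
    exists! h : Hom T P, p o h = u /\ q o h = v.

(** [E] with [ev : E * A -> B] is the exponential of [B] by [A], where the
    object [P] with projections [p], [q] is a product of [E] and [A]; the
    morphism [k] below is [h * id : T * A -> E * A]. *)
Definition is_exponential (A B E P : C) (p : Hom P E) (q : Hom P A)
    (ev : Hom P B) : Prop :=
  is_product p q /\
  forall (T Q : C) (p' : Hom Q T) (q' : Hom Q A), is_product p' q' ->
  forall g : Hom Q B, exists! h : Hom T E,
    forall k : Hom Q P, p o k = h o p' -> q o k = q' -> ev o k = g.

Definition is_subobject_classifier (one Omega : C) (t : Hom one Omega) : Prop :=
  is_terminal one /\
  forall (U A : C) (m : Hom U A), monic m ->
    exists! chi : Hom A Omega,
      exists u : Hom U one, is_pullback chi t m u.

End Universal.

(** Finite limits are given in the form of a terminal object, binary products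
    and equalizers. *)
Record elementary_topos (E : category) : Prop := ElementaryTopos {
  topos_terminal : exists one : E, is_terminal one;
  topos_product : forall A B : E,
    exists (P : E) (p : Hom P A) (q : Hom P B), is_product p q;
  topos_equalizer : forall (A B : E) (f g : Hom A B),
    exists (K : E) (e : Hom K A), is_equalizer f g e;
  topos_exponential : forall A B : E,
    exists (X P : E) (p : Hom P X) (q : Hom P A) (ev : Hom P B),
      is_exponential p q ev;
  topos_classifier : exists (one Omega : E) (t : Hom one Omega),
    is_subobject_classifier t
}.

Section Subobjects.
Context {C : category}.

(** The subobjects of [A] are represented by monomorphisms into [A], preordered
    by factorization; two of them are the same subobject when each one factors
    through the other. *)
Record subobject (A : C) := Subobject {
  sub_dom : C;
  sub_arr : Hom sub_dom A;
  sub_monic : monic sub_arr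
}.

Variable A : C.
Implicit Types U V W : subobject A.

Definition sub_le U V : Prop :=
  exists h : Hom (sub_dom U) (sub_dom V), sub_arr V o h = sub_arr U.

Definition sub_bottom U : Prop := forall V, sub_le U V.

Definition sub_top U : Prop := forall V, sub_le V U.

Definition sub_meet U V W : Prop :=
  forall T, sub_le T W <-> sub_le T U /\ sub_le T V.

Definition sub_join U V W : Prop :=
  forall T, sub_le W T <-> sub_le U T /\ sub_le V T.

Definition sub_complement U V : Prop :=
  (exists W, sub_meet U V W /\ sub_bottom W) /\
  (exists W, sub_join U V W /\ sub_top W).

End Subobjects.

(** In a topos the poset of subobjects of [A] is a Heyting algebra, hence it is
    a Boolean algebra exactly when all its elements have a complement. *)
Definition boolean (E : category) : Prop :=
  forall (A : E) (U : subobject A), exists V : subobject A, sub_complement U V.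

Section Pointed.
Context {E : category}.
Variable one : E.

Record pointed_object := PointedObject {
  carrier : E;
  point : Hom one carrier
}.

Definition pointed_hom (A B : pointed_object) : Type :=
  {f : Hom (carrier A) (carrier B) | f o point A = point B}.

Lemma pointed_hom_eq (A B : pointed_object) (f g : pointed_hom A B) :
  proj1_sig f = proj1_sig g -> f = g.
Proof.
destruct f as [f hf], g as [g hg]; simpl; intros e.
now apply subset_eq_compat.
Qed.

Definition pointed_id (A : pointed_object) : pointed_hom A A :=
  exist _ (idm (carrier A)) (comp_idl (point A)).

Lemma pointed_comp_subproof (A B D : pointed_object)
    (g : pointed_hom B D) (f : pointed_hom A B) :
  proj1_sig g o proj1_sig f o point A = point D.
Proof.
now rewrite <- comp_assoc, (proj2_sig f), (proj2_sig g).
Qed.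

Definition pointed_comp (A B D : pointed_object)
    (g : pointed_hom B D) (f : pointed_hom A B) : pointed_hom A D :=
  exist _ (proj1_sig g o proj1_sig f) (pointed_comp_subproof g f).

Definition pointed : category.
Proof.
refine (@Category pointed_object pointed_hom pointed_id pointed_comp _ _ _);
  intros; apply pointed_hom_eq; simpl.
- apply comp_idl.
- apply comp_idr.
- apply comp_assoc.
Defined.

End Pointed.

Section NormalEpi.
Context {C : category}.

Definition is_zero_object (Z : C) : Prop := is_initial Z /\ is_terminal Z.

Definition is_zero_morphism {A B : C} (f : Hom A B) : Prop :=
  exists (Z : C) (h : Hom Z B) (g : Hom A Z), is_zero_object Z /\ f = h o g.

Definition is_cokernel {A B Q : C} (f : Hom A B) (q : Hom B Q) : Prop :=
  is_zero_morphism (q o f) /\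
  forall (T : C) (g : Hom B T), is_zero_morphism (g o f) ->
    exists! h : Hom Q T, h o q = g.

Definition normal_epi {B Q : C} (q : Hom B Q) : Prop :=
  exists (A : C) (f : Hom A B), is_cokernel f q.

End NormalEpi.

Lemma pointed_zero_object (E : category) (one : E) :
  is_terminal one -> @is_zero_object (pointed one) (PointedObject (idm one)).
Proof.
intros h1.
assert (u : forall (A : E) (f g : Hom A one), f = g).
{ intros A f g; destruct (h1 A) as [k hk]; now rewrite (hk f), (hk g). }
split; intros A.
- unshelve eexists.
  + exists (point A); apply comp_idr.
  + intros [g hg]; apply pointed_hom_eq; simpl in *.
    now rewrite <- hg, comp_idr.
- destruct (h1 (carrier A)) as [k _].
  unshelve eexists.
  + exists k; apply u.
  + intros g; apply pointed_hom_eq, u.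
Qed.

Section Slice.
Context {C : category}.
Variable X : C.

Record slice_object := SliceObject {
  slice_dom : C;
  slice_arr : Hom slice_dom X
}.

Definition slice_hom (A B : slice_object) : Type :=
  {f : Hom (slice_dom A) (slice_dom B) | slice_arr B o f = slice_arr A}.

Lemma slice_hom_eq (A B : slice_object) (f g : slice_hom A B) :
  proj1_sig f = proj1_sig g -> f = g.
Proof.
destruct f as [f hf], g as [g hg]; simpl; intros e.
now apply subset_eq_compat.
Qed.

Definition slice_id (A : slice_object) : slice_hom A A :=
  exist _ (idm (slice_dom A)) (comp_idr (slice_arr A)).

Lemma slice_comp_subproof (A B D : slice_object)
    (g : slice_hom B D) (f : slice_hom A B) :
  slice_arr D o (proj1_sig g o proj1_sig f) = slice_arr A.
Proof.
now rewrite comp_assoc, (proj2_sig g), (proj2_sig f).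
Qed.

Definition slice_comp (A B D : slice_object)
    (g : slice_hom B D) (f : slice_hom A B) : slice_hom A D :=
  exist _ (proj1_sig g o proj1_sig f) (slice_comp_subproof g f).

Definition slice : category.
Proof.
refine (@Category slice_object slice_hom slice_id slice_comp _ _ _);
  intros; apply slice_hom_eq; simpl.
- apply comp_idl.
- apply comp_idr.
- apply comp_assoc.
Defined.

End Slice.

Definition full_subcategory (C : category) (P : C -> Prop) : category :=
  @Category {A : C | P A}
    (fun A B => Hom (proj1_sig A) (proj1_sig B))
    (fun A => idm (proj1_sig A))
    (fun A B D g f => g o f)
    (fun A B f => comp_idl f)
    (fun A B f => comp_idr f)
    (fun A B D F h g f => comp_assoc h g f).

Definition normal_covers {C : category} (X : C) : category :=
  @full_subcategory (slice X) (fun A => normal_epi (slice_arr A)).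

Definition is_initial_normal_cover {C : category} {Y X : C} (f : Hom Y X) : Prop :=
  exists hf : normal_epi f,
    @is_initial (normal_covers X) (exist _ (SliceObject f) hf).

(* Main.v *)
From Stdlib Require Import Setoid.
Require Import Defs.

Set Implicit Arguments.
Unset Strict Implicit.

(** An initial object [id_X] among the normal covers of [X] means that every
    normal epimorphism [q : B -> X] has exactly one section in the category of
    pointed objects ([normal_epi_unique_section]). The set-theoretic reason is
    that a normal epimorphism collapses its kernel to the base point and is
    bijective over the remaining points, so that the unique section sends the
    base point to the base point and inverts [q] elsewhere. Booleanness makes
    this case distinction legitimate: the base point of [X] has a complement
    [V], and [X] is the coproduct of the two.

    The argument is arranged so that all case distinctions are made on [X], instead
    of on [B] by pulling the decomposition back along [q]. For a pointed
    object [Y] let [mY : X * Y -> Y] be the map with [mY(x, y)] the base point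
    of [Y] when [x] is the base point, and [mY(x, y) = y] when [x] is in [V]
    ([conditional]). Put [r(b) = mB(q(b), b)].
    - If [q] is a cokernel of [f], then [r] kills the image of [f], because [q]
      does. Hence [r = s o q] for a pointed map [s].
    - The equations [q(mB(x, b)) = mX(x, q(b))] and [mX(x, x) = x] may be
      checked for [x] the base point and for [x] in [V]. They give [q o r = q],
      thus [q o s = id], as [q] is epic.
    - If [s'] is another section, then [r(s'(x)) = mB(x, s'(x))], which is
      [s'(x)] in both cases; so [s' = r o s' = s o q o s' = s].

    Two facts about a topos support this. The two parts of a complementary
    decomposition of [A] are jointly epic, and remain so after multiplication
    with a further object ([jointly_epic_product]), by exponential
    transposition. A map out of [A] can be defined by cases
    ([complement_copair]): the two given maps to [T] define a relation between
    [A] and [T], hence a map from [A] to the power object of [T], and this map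
    takes values in singletons since it does so on both parts.

    Reasoning is with generalized elements: [factors m z] says that the element
    [z] of [A] belongs to the subobject [m]. *)

(** * Generalized elements *)

Section Elements.
Context {C : category}.

Definition factors {U A Z : C} (m : Hom U A) (z : Hom Z A) : Prop :=
  exists s : Hom Z U, m o s = z.

Lemma factors_comp (U A Z Y : C) (m : Hom U A) (z : Hom Z A) (s : Hom Y Z) :
  factors m z -> factors m (z o s).
Proof.
intros [r <-]. exists (r o s). apply comp_assoc.
Qed.

Lemma monic_comp (A B D : C) (n : Hom B D) (m : Hom A B) :
  monic n -> monic m -> monic (n o m).
Proof.
intros hn hm T f g e. apply hm, hn. now rewrite !comp_assoc.
Qed.

Lemma terminal_eq (one : C) : is_terminal one -> forall (A : C) (f g : Hom A one), f = g.
Proof.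
intros h A f g. destruct (h A) as [k hk]. now rewrite (hk f), (hk g).
Qed.

Lemma terminal_monic (one A : C) (a : Hom one A) : is_terminal one -> monic a.
Proof.
intros h T f g _. now apply terminal_eq.
Qed.

Lemma pair_exists (A B P : C) (p : Hom P A) (q : Hom P B) : is_product p q ->
  forall (Z : C) (x : Hom Z A) (y : Hom Z B), exists z, p o z = x /\ q o z = y.
Proof.
intros h Z x y. destruct (h Z x y) as [z [hz _]]. now exists z.
Qed.

Lemma pair_unique (A B P : C) (p : Hom P A) (q : Hom P B) : is_product p q ->
  forall (Z : C) (z w : Hom Z P), p o z = p o w -> q o z = q o w -> z = w.
Proof.
intros h Z z w hp hq.
destruct (h Z (p o w) (q o w)) as [v [_ hv]].
transitivity v; [symmetry|]; apply hv; auto.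
Qed.

Lemma equalizer_monic (A B : C) (f g : Hom A B) (K : C) (e : Hom K A) :
  is_equalizer f g e -> monic e.
Proof.
intros [he hu] T x y exy.
destruct (hu T (e o y)) as [k [_ hk]].
- now rewrite !comp_assoc, he.
- transitivity k; [symmetry|]; apply hk; auto.
Qed.

Lemma equalizer_factors (A B : C) (f g : Hom A B) (K : C) (e : Hom K A) :
  is_equalizer f g e ->
  forall (Z : C) (z : Hom Z A), factors e z <-> f o z = g o z.
Proof.
intros [he hu] Z z; split.
- intros [s <-]. now rewrite !comp_assoc, he.
- intros hz. destruct (hu Z z hz) as [k [hk _]]. now exists k.
Qed.

(** Truth of [w] is expressed by [factors t w]; an arrow into [Omega] is then
    known by the elements at which it is true. *)
Definition truth_values {one Omega : C} (t : Hom one Omega) : Prop :=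
  (forall (U A : C) (m : Hom U A), monic m ->
     exists chi : Hom A Omega,
       forall (Z : C) (z : Hom Z A), factors t (chi o z) <-> factors m z) /\
  (forall (Z : C) (v w : Hom Z Omega),
     (forall (Y : C) (s : Hom Y Z), factors t (v o s) <-> factors t (w o s)) ->
     v = w).

(** The universal property of an exponential with evaluation expressed on
    generalized elements, which avoids choosing a product for each domain: an
    element [z] of [P] is a pair of a function and an argument. *)
Definition pointwise_exponential {A B X P : C} (p : Hom P X) (q : Hom P A)
    (ev : Hom P B) : Prop :=
  is_product p q /\
  (forall (T Q : C) (p' : Hom Q T) (q' : Hom Q A), is_product p' q' ->
     forall g : Hom Q B, exists h : Hom T X,
       forall (Z : C) (z : Hom Z P) (w : Hom Z Q),
         p o z = h o (p' o w) -> q o z = q' o w -> ev o z = g o w) /\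
  (forall (T : C) (h k : Hom T X),
     (forall (Z : C) (x : Hom Z T) (z w : Hom Z P),
        p o z = h o x -> p o w = k o x -> q o z = q o w -> ev o z = ev o w) ->
     h = k).

(** The families of arrows into [A] are encoded by predicates, so that pairs of
    subobjects and the empty family are treated alike. *)
Definition jointly_epic {A : C} (S : forall Z : C, Hom Z A -> Prop) : Prop :=
  forall (Y : C) (f g : Hom A Y),
    (forall (Z : C) (z : Hom Z A), S Z z -> f o z = g o z) -> f = g.

(** In a topos these are the initial objects. *)
Definition degenerate (Z : C) : Prop := forall (Y : C) (f g : Hom Z Y), f = g.

End Elements.

(** * Truth values, comprehension and exponentials in a topos *)

Section Topos.
Context {E : category}.
Context (hE : elementary_topos E).

(** Extensionality is the uniqueness of characters: two truth values that hold
    at the same elements are both characters of the same subobject. *)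
Lemma topos_truth_values :
  exists (one Omega : E) (t : Hom one Omega), is_terminal one /\ truth_values t.
Proof.
destruct (topos_classifier hE) as (one & Omega & t & h1 & hcl).
exists one, Omega, t; split; [exact h1|split].
- intros U A m hm.
  destruct (hcl U A m hm) as [chi [[u [hsq hpb]] _]].
  exists chi; intros Z z; split.
  + intros [v hv]. destruct (hpb Z z v (eq_sym hv)) as [s [[hs _] _]].
    now exists s.
  + intros [s <-]. exists (u o s). now rewrite !comp_assoc, hsq.
- intros Z v w hvw.
  destruct (h1 Z) as [bang _].
  (* The subobject of [Z] of which [v] is a character, and then [w] as well. *)
destruct (topos_equalizer hE v (t o bang)) as (K & m & hm).
  assert (fact : forall (Y : E) (s : Hom Y Z), factors t (v o s) <-> factors m s).
  { intros Y s. rewrite (equalizer_factors hm), <- comp_assoc; split.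
    - intros [r <-]. f_equal. now apply terminal_eq.
    - intros ->. now exists (bang o s). }
  pose proof (equalizer_monic hm) as mm.
  assert (pb : forall x : Hom Z Omega,
     (forall (Y : E) (s : Hom Y Z), factors t (x o s) <-> factors m s) ->
     exists u : Hom K one, is_pullback x t m u).
  { intros x hx. destruct (proj2 (hx K m)) as [u hu].
    { exists (idm K). apply comp_idr. }
    exists u; split; [easy|]. intros T y s hys.
    destruct (proj1 (hx T y)) as [r hr]; [now exists s|].
    exists r; split.
    - split; [exact hr|now apply terminal_eq].
    - intros r' [hr' _]. apply mm. now rewrite hr. }
  destruct (hcl K Z m mm) as [chi [_ hchi]].
  transitivity chi; [symmetry|]; apply hchi, pb; [exact fact|].
  intros Y s. now rewrite <- hvw.
Qed.

Lemma inverse_image (U A B : E) (m : Hom U B) (f : Hom A B) : monic m ->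
  exists (V : E) (n : Hom V A), monic n /\
    forall (Z : E) (z : Hom Z A), factors n z <-> factors m (f o z).
Proof.
intros hm.
destruct topos_truth_values as (one & Omega & t & h1 & hchar & _).
destruct (hchar U B m hm) as [chi hchi].
destruct (h1 A) as [bang _].
destruct (topos_equalizer hE (chi o f) (t o bang)) as (V & n & hn).
exists V, n; split; [exact (equalizer_monic hn)|].
intros Z z. rewrite (equalizer_factors hn), <- hchi, comp_assoc, <- (comp_assoc t); split.
- intros ->. now exists (bang o z).
- intros [r <-]. f_equal. now apply terminal_eq.
Qed.

Lemma intersection (U V A : E) (m : Hom U A) (n : Hom V A) : monic m -> monic n ->
  exists (W : E) (r : Hom W A), monic r /\
    forall (Z : E) (z : Hom Z A), factors r z <-> factors m z /\ factors n z.
Proof.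
intros hm hn.
destruct (inverse_image n hm) as (W & r & hr & fr).
exists W, (n o r); split; [now apply monic_comp|].
intros Z z; split.
- intros [s <-]. rewrite <- comp_assoc. split.
  + apply fr. now exists s.
  + now exists (r o s).
- intros [h1 [s <-]]. apply fr in h1. destruct h1 as [s' <-].
  exists s'. symmetry. apply comp_assoc.
Qed.

Lemma topos_pointwise_exponential (A B : E) :
  exists (X P : E) (p : Hom P X) (q : Hom P A) (ev : Hom P B),
    pointwise_exponential p q ev.
Proof.
destruct (topos_exponential hE A B) as (X & P & p & q & ev & hP & hexp).
exists X, P, p, q, ev; split; [exact hP|split].
- intros T Q p' q' hQ g.
  destruct (hexp T Q p' q' hQ g) as [h [hh _]].
  exists h; intros Z z w hp hq.
  destruct (pair_exists hP (h o p') q') as [k [kp kq]].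
  rewrite <- (hh k kp kq), <- comp_assoc. f_equal.
  apply (pair_unique hP).
  + now rewrite hp, !comp_assoc, kp.
  + now rewrite hq, comp_assoc, kq.
- intros T h k hhk.
  destruct (topos_product hE T A) as (Q & p' & q' & hQ).
  destruct (pair_exists hP (h o p') q') as [z [zp zq]].
  destruct (hexp T Q p' q' hQ (ev o z)) as [l [_ hl]].
  transitivity l; [symmetry|]; apply hl; intros w wp wq.
  + f_equal. apply (pair_unique hP); congruence.
  + symmetry. apply (hhk Q p'); congruence.
Qed.

(** The functor [- * T] has a right adjoint: two maps [A * T -> Y] agree as soon
    as their transposes [A -> Y ^ T] do, and these can be compared on [S]. *)
Lemma jointly_epic_product (A T P : E) (p : Hom P A) (q : Hom P T)
    (S : forall Z : E, Hom Z A -> Prop) :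
  (forall (Z Y : E) (z : Hom Z A) (s : Hom Y Z), S Z z -> S Y (z o s)) ->
  is_product p q -> jointly_epic S ->
  jointly_epic (fun Z (z : Hom Z P) => S Z (p o z)).
Proof.
intros stable hP hS Y f g hfg.
destruct (topos_pointwise_exponential T Y)
  as (X & R & a & b & ev & hR & curry & ext).
destruct (curry A P p q hP f) as [f' hf'].
destruct (curry A P p q hP g) as [g' hg'].
assert (e : f' = g').
{ apply hS. intros Z z hz. apply ext. intros V x u w au aw buw.
  destruct (pair_exists hP (z o x) (b o u)) as [v [pv qv]].
  rewrite (hf' V u v), (hg' V w v); try congruence.
  - apply hfg. rewrite pv. now apply stable.
  - now rewrite aw, pv, comp_assoc.
  - now rewrite au, pv, comp_assoc. }
subst g'.
destruct (pair_exists hR (f' o p) q) as [z [az bz]].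
rewrite <- (comp_idr f), <- (comp_idr g).
rewrite <- (hf' P z (idm P)), <- (hg' P z (idm P)); rewrite ?comp_idr; auto.
Qed.

(** The equalizer of two maps out of [W] is a subobject of [A] below [W]. *)
Lemma bottom_degenerate (A : E) (W : subobject A) :
  sub_bottom W -> degenerate (sub_dom W).
Proof.
intros hW Y f g.
destruct (topos_equalizer hE f g) as (K & e & he).
pose proof (monic_comp (@sub_monic _ _ W) (equalizer_monic he)) as hm.
destruct (hW (Subobject hm)) as [s hs]; simpl in *.
rewrite <- (comp_idr f), <- (comp_idr g).
apply (equalizer_factors he). exists s.
apply (@sub_monic _ _ W). now rewrite comp_assoc, comp_idr.
Qed.

(** Initial objects are strict: the empty family is jointly epic on [W], hence
    on [W * Z], and [Z] is a retract of [W * Z]. *)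
Lemma degenerate_strict (Z W : E) (z : Hom Z W) : degenerate W -> degenerate Z.
Proof.
intros hW Y f g.
destruct (topos_product hE W Z) as (P & p & q & hP).
assert (e : f o q = g o q).
{ apply (jointly_epic_product (S:=fun _ _ => False) (p:=p) (q:=q)); easy. }
destruct (pair_exists hP z (idm Z)) as [d [_ hd]].
now rewrite <- (comp_idr f), <- (comp_idr g), <- hd, !comp_assoc, e.
Qed.

(** * Complementary subobjects *)

Section Complement.
Context {A : E} {U V : subobject A}.
Context (hUV : sub_complement U V).
Notation k := (sub_arr U).
Notation l := (sub_arr V).

(** The meet of the two subobjects is only described by means of subobjects of
    [A]; an arbitrary common element reaches it through their intersection. *)
Lemma complement_disjoint (Z : E) (x : Hom Z (sub_dom U)) (y : Hom Z (sub_dom V)) :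
  k o x = l o y -> degenerate Z.
Proof.
intros hxy.
destruct hUV as [[W [hmeet hbot]] _].
destruct (intersection (@sub_monic _ _ U) (@sub_monic _ _ V))
  as (I & i & mi & fi).
assert (hI : sub_le (Subobject mi) W).
{ apply hmeet. apply fi. exists (idm I). apply comp_idr. }
destruct hI as [s hs]; simpl in s.
destruct (proj2 (fi Z (k o x))) as [r _].
{ split; [now exists x|now exists y]. }
apply (degenerate_strict (s o r)), (bottom_degenerate hbot).
Qed.

Lemma complement_cover (W : E) (m : Hom W A) : monic m ->
  factors m k -> factors m l -> factors m (idm A).
Proof.
intros hm hk hl.
destruct hUV as [_ [T [hjoin htop]]].
assert (hid : monic (idm A)).
{ intros Z f g. now rewrite !comp_idl. }
destruct (htop (Subobject hid)) as [i hi].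
destruct (proj2 (hjoin (Subobject hm)) (conj hk hl)) as [j hj].
simpl in *. exists (j o i). now rewrite comp_assoc, hj.
Qed.

Definition in_either (Z : E) (z : Hom Z A) : Prop := factors k z \/ factors l z.

Lemma complement_jointly_epic : jointly_epic in_either.
Proof.
intros Y f g hfg.
destruct (topos_equalizer hE f g) as (K & e & he).
rewrite <- (comp_idr f), <- (comp_idr g).
apply (equalizer_factors he), complement_cover.
- exact (equalizer_monic he).
- apply (equalizer_factors he), hfg. left. exists (idm _). apply comp_idr.
- apply (equalizer_factors he), hfg. right. exists (idm _). apply comp_idr.
Qed.

Lemma in_either_comp (Z Y : E) (z : Hom Z A) (s : Hom Y Z) :
  in_either z -> in_either (z o s).
Proof.
intros [h|h]; [left|right]; now apply factors_comp.
Qed.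

End Complement.

(** The relation [x \in K -> y = a(x)] on pairs [(x, y)] of [A * T]. An
    implication [u -> v] between truth values with [v <= u] is the equation
    [v = u]; here [v] is membership in the graph [m] of [a], and [u] is
    membership of the first component in [K]. Over [K] the relation is the graph
    of [a], and away from [K] it is everything. *)
Lemma conditional_graph (A K T P : E) (k : Hom K A) (a : Hom K T)
    (p : Hom P A) (q : Hom P T) : is_product p q -> monic k ->
  exists (R : E) (r : Hom R P), monic r /\
    (forall (Z : E) (z : Hom Z P) (x : Hom Z K), p o z = k o x ->
       (factors r z <-> q o z = a o x)) /\
    (forall (Z : E) (z : Hom Z P),
       (forall (Y : E) (s : Hom Y Z) (x : Hom Y K),
          p o z o s = k o x -> degenerate Y) ->
       factors r z).
Proof.
intros hP hk.
destruct topos_truth_values as (one & Omega & t & _ & hchar & ext).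
destruct (pair_exists hP k a) as [m [pm qm]].
assert (mm : monic m).
{ intros Z f g e. apply hk. now rewrite <- pm, <- !comp_assoc, e. }
destruct (hchar _ _ m mm) as [c hc].
destruct (hchar _ _ k hk) as [d hd].
destruct (topos_equalizer hE c (d o p)) as (R & r & hr).
assert (graph : forall (Z : E) (z : Hom Z P) (x : Hom Z K), p o z = k o x ->
          (factors m z <-> q o z = a o x)).
{ intros Z z x hx; split.
  - intros [y <-]. rewrite !comp_assoc, pm in *. rewrite qm.
    f_equal. now apply hk.
  - intros hy. exists x. apply (pair_unique hP).
    + now rewrite comp_assoc, pm.
    + now rewrite comp_assoc, qm. }
exists R, r; split; [exact (equalizer_monic hr)|split].
- intros Z z x hx. rewrite (equalizer_factors hr), <- comp_assoc, <- (graph Z z x hx).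
  assert (inK : factors t (d o (p o z))) by (apply hd; now exists x).
  rewrite <- hc; split.
  + now intros ->.
  + intros hz. apply ext. intros Y s; split; intros _; now apply factors_comp.
- intros Z z hz. rewrite (equalizer_factors hr).
  apply ext. intros Y s. rewrite <- !comp_assoc, hc, hd, !comp_assoc.
  split.
  + intros [x hx]. exists x. now rewrite <- pm, <- !comp_assoc, hx.
  + intros [x hx]. symmetry in hx. pose proof (hz Y s x hx) as dY.
    apply (graph Y _ x); [now rewrite comp_assoc|apply dY].
Qed.

(** The map from [T] to its power object [X], obtained by transposing the
    character of the diagonal of [T]. *)
Lemma singleton_map (T X P Omega one : E) (t : Hom one Omega)
    (p : Hom P X) (q : Hom P T) (ev : Hom P Omega) :
  truth_values t -> pointwise_exponential p q ev ->
  exists sg : Hom T X, monic sg /\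
    forall (Z : E) (z : Hom Z P) (x : Hom Z T), p o z = sg o x ->
      (factors t (ev o z) <-> q o z = x).
Proof.
intros [hchar _] [hP [curry _]].
destruct (topos_product hE T T) as (Q & p' & q' & hQ).
destruct (pair_exists hQ (idm T) (idm T)) as [d [pd qd]].
assert (md : monic d).
{ intros Z f g e. now rewrite <- (comp_idl f), <- (comp_idl g), <- pd, <- !comp_assoc, e. }
destruct (hchar _ _ d md) as [c hc].
destruct (curry T Q p' q' hQ c) as [sg hsg].
assert (spec : forall (Z : E) (z : Hom Z P) (x : Hom Z T), p o z = sg o x ->
          (factors t (ev o z) <-> q o z = x)).
{ intros Z z x hx.
  destruct (pair_exists hQ x (q o z)) as [w [pw qw]].
  rewrite (hsg Z z w), hc; try congruence. split.
  - intros [y <-]. rewrite comp_assoc, pd, comp_idl in pw.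
    rewrite comp_assoc, qd, comp_idl in qw. congruence.
  - intros hy. exists x. apply (pair_unique hQ);
      rewrite comp_assoc, ?pd, ?qd, comp_idl; congruence. }
exists sg; split; [|exact spec].
intros Z x y hxy.
destruct (pair_exists hP (sg o x) x) as [z [pz qz]].
rewrite <- qz. apply (spec Z z y); [congruence|]. now apply (spec Z z x).
Qed.

(** The relation [(x \in U -> y = a(x)) /\ (x \in V -> y = b(x))] transposes to
    a map [sigma] from [A] to the power object of [T]. By disjointness [sigma]
    is [x |-> {a(x)}] on [U] and [x |-> {b(x)}] on [V]. The inverse image along
    [sigma] of the subobject of singletons contains [U] and [V], so it is all of
    [A], and [sigma] factors through the singleton map. *)
Lemma complement_copair (A : E) (U V : subobject A) (T : E)
    (a : Hom (sub_dom U) T) (b : Hom (sub_dom V) T) : sub_complement U V ->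
  exists h : Hom A T, h o sub_arr U = a /\ h o sub_arr V = b.
Proof.
intros hUV.
destruct topos_truth_values as (one & Omega & t & h1 & tv).
destruct (topos_pointwise_exponential T Omega) as (X & P & p & q & ev & hexp).
destruct (singleton_map tv hexp) as [sg [msg hsg]].
destruct hexp as [hP [curry ext]].
destruct tv as [hchar text].
destruct (topos_product hE A T) as (Q & p' & q' & hQ).
destruct (conditional_graph a hQ (@sub_monic _ _ U))
  as (R1 & r1 & m1 & on1 & off1).
destruct (conditional_graph b hQ (@sub_monic _ _ V))
  as (R2 & r2 & m2 & on2 & off2).
destruct (intersection m1 m2) as (R & r & mr & hr).
destruct (hchar _ _ r mr) as [c hc].
destruct (curry A Q p' q' hQ c) as [sigma hsigma].
assert (value : forall (W : E) (k : Hom W A) (d : Hom W T),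
  (forall (Z : E) (z : Hom Z Q) (x : Hom Z W), p' o z = k o x ->
     (factors r z <-> q' o z = d o x)) ->
  sigma o k = sg o d).
{ intros W k d hk. apply ext. intros Z x z w pz pw qzw.
  destruct (pair_exists hQ (k o x) (q o z)) as [v [pv qv]].
  rewrite (hsigma Z z v); [|now rewrite pv, comp_assoc|now symmetry].
  apply text. intros Y s. rewrite <- !comp_assoc, hc.
  rewrite (hk Y (v o s) (x o s)), (hsg Y (w o s) (d o (x o s))).
  - now rewrite !comp_assoc, qv, qzw.
  - now rewrite !comp_assoc, pw.
  - now rewrite !comp_assoc, pv. }
assert (hU : sigma o sub_arr U = sg o a).
{ apply value. intros Z z x hx. rewrite hr, (on1 Z z x hx).
  split; [now intros [? _]|]. intros hy; split; [exact hy|].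
  apply off2. intros Y s y hy'.
  apply (complement_disjoint hUV (x:=x o s) (y:=y)). now rewrite comp_assoc, <- hx. }
assert (hV : sigma o sub_arr V = sg o b).
{ apply value. intros Z z x hx. rewrite hr, (on2 Z z x hx).
  split; [now intros [_ ?]|]. intros hy; split; [|exact hy].
  apply off1. intros Y s y hy'.
  apply (complement_disjoint hUV (x:=y) (y:=x o s)). now rewrite comp_assoc, <- hx. }
destruct (inverse_image sigma msg) as (S & n & mn & fn).
destruct (proj1 (fn A (idm A))) as [h hh].
{ apply (complement_cover hUV mn); apply fn; rewrite ?hU, ?hV;
    [now exists a|now exists b]. }
rewrite comp_idr in hh. exists h.
split; apply msg; rewrite comp_assoc, hh; assumption.
Qed.

(** The copairing [phi : A -> Y ^ Y] is the constant function [y0] on [U] and the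
    identity function on [V]; then [m(x, y) = phi(x)(y)]. The exponential
    reduces a definition by cases on [A * Y] to one on [A]. *)
Lemma conditional (one : E) (A Y P : E) (U V : subobject A)
    (p : Hom P A) (q : Hom P Y) (y0 : Hom one Y) :
  is_terminal one -> sub_complement U V -> is_product p q ->
  exists m : Hom P Y,
    (forall (Z : E) (z : Hom Z P) (w : Hom Z one),
       factors (sub_arr U) (p o z) -> m o z = y0 o w) /\
    (forall (Z : E) (z : Hom Z P),
       factors (sub_arr V) (p o z) -> m o z = q o z).
Proof.
intros h1 hUV hP.
destruct (topos_pointwise_exponential Y Y) as (X & R & a & b & ev & hR & curry & _).
destruct (topos_product hE one Y) as (Q & p' & q' & hQ).
destruct (curry one Q p' q' hQ (y0 o p')) as [cst hcst].
destruct (curry one Q p' q' hQ q') as [id hid].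
destruct (h1 (sub_dom U)) as [bU _].
destruct (h1 (sub_dom V)) as [bV _].
destruct (complement_copair (cst o bU) (id o bV) hUV) as [phi [phiU phiV]].
destruct (pair_exists hR (phi o p) q) as [n [an bn]].
exists (ev o n); split.
- intros Z z w [x hx].
  destruct (pair_exists hQ (bU o x) (q o z)) as [v [pv qv]].
  rewrite <- comp_assoc, (hcst Z (n o z) v).
  + rewrite <- comp_assoc. f_equal. now apply terminal_eq.
  + rewrite comp_assoc, an, <- comp_assoc, <- hx, comp_assoc, phiU, pv.
    now rewrite comp_assoc.
  + now rewrite comp_assoc, bn.
- intros Z z [x hx].
  destruct (pair_exists hQ (bV o x) (q o z)) as [v [pv qv]].
  rewrite <- comp_assoc, (hid Z (n o z) v); [exact qv| |].
  + rewrite comp_assoc, an, <- comp_assoc, <- hx, comp_assoc, phiV, pv.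
    now rewrite comp_assoc.
  + now rewrite comp_assoc, bn.
Qed.

End Topos.

(** * Normal epimorphisms of pointed objects *)

Section PointedObjects.
Context {E : category} {one : E}.
Context (hone : is_terminal one).

Lemma zero_morphism_factors (A B : pointed one) (f : Hom A B) :
  is_zero_morphism f <-> factors (point B) (proj1_sig f).
Proof.
pose proof (pointed_zero_object hone) as hz.
split.
- intros (Z & h & g & [hZ _] & ->).
  destruct (hZ (PointedObject (idm one))) as [j _].
  destruct (proj1 hz B) as [i _].
  destruct (hZ B) as [h' hh'].
  rewrite (hh' h), <- (hh' (i o j)).
  exists (proj1_sig j o proj1_sig g). simpl.
  pose proof (proj2_sig i) as hi. simpl in hi. rewrite comp_idr in hi.
  now rewrite hi, comp_assoc.
- intros [w hw].
  destruct (proj2 hz A) as [g _].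
  destruct (proj1 hz B) as [i _].
  exists (PointedObject (idm one)), i, g; split; [exact hz|].
  apply pointed_hom_eq. simpl.
  pose proof (proj2_sig i) as hi. simpl in hi. rewrite comp_idr in hi.
  rewrite hi, <- hw. f_equal. now apply terminal_eq.
Qed.

Lemma cokernel_epic (A B Q : pointed one) (f : Hom A B) (q : Hom B Q) :
  is_cokernel f q ->
  forall (T : pointed one) (g h : Hom Q T), g o q = h o q -> g = h.
Proof.
intros [hz hq] T g h e.
destruct (hq T (h o q)) as [k [_ hk]].
- destruct hz as (Z & u & v & hZ & huv).
  exists Z, (h o u), v; split; [exact hZ|].
  now rewrite <- !comp_assoc, huv.
- transitivity k; [symmetry|]; apply hk; auto.
Qed.

(** The identity is the cokernel of the morphism from the zero object. *)
Lemma id_normal_epi (X : pointed one) : normal_epi (idm X).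
Proof.
pose proof (pointed_zero_object hone) as hz.
destruct (proj1 hz X) as [i _].
exists (PointedObject (idm one)), i; split.
- exists (PointedObject (idm one)), i, (idm _); split; [exact hz|].
  now rewrite comp_idl, comp_idr.
- intros T g _. exists g; split; [apply comp_idr|].
  intros h <-. apply comp_idr.
Qed.

(** With [mB] and [mX] the conditional maps of [B] and [X], the section [s] is
    the factorization through [q] of [r(b) = mB(q(b), b)]. *)
Lemma normal_epi_unique_section (hE : elementary_topos E) (hB : boolean E)
    (B X : pointed one) (q : Hom B X) :
  normal_epi q -> exists s : Hom X B, q o s = idm X /\
    forall s' : Hom X B, q o s' = idm X -> s' = s.
Proof.
intros (A & f & hq).
pose proof hq as [hqf huniv].
pose (q' := proj1_sig q : Hom (carrier B) (carrier X)).
assert (qpt : q' o point B = point X) by exact (proj2_sig q).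
pose (pt := Subobject (terminal_monic hone (a:=point X))).
destruct (hB _ pt) as [V hV].
destruct (topos_product hE (carrier X) (carrier B)) as (P & p1 & p2 & hP).
destruct (topos_product hE (carrier X) (carrier X)) as (Q & q1 & q2 & hQ).
destruct (conditional hE (point B) hone hV hP)
  as [mB [mB0 mB1]].
destruct (conditional hE (point X) hone hV hQ)
  as [mX [mX0 mX1]].
pose proof (complement_jointly_epic hE hV) as cover.
destruct (pair_exists hP q' (idm (carrier B))) as [g [g1 g2]].
assert (atpt : forall (Z : E) (x : Hom Z one) (z : Hom Z (carrier B)),
          q' o z = point X o x -> mB o g o z = point B o x).
{ intros Z x z hx. rewrite <- comp_assoc. apply mB0.
  exists x. simpl. now rewrite comp_assoc, g1. }
assert (rpt : mB o g o point B = point B).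
{ rewrite (atpt one (idm one)); [apply comp_idr|].
  now rewrite qpt, comp_idr. }
pose (r := exist _ (mB o g) rpt : @Hom (pointed one) B B).
(* [q(mB(x, b)) = mX(x, q(b))] is [e1], and [mX(x, x) = x] is [e2]; the
   substitution [x = q(b)] combines them. *)
assert (qr : q' o (mB o g) = q').
{ destruct (pair_exists hQ p1 (q' o p2)) as [n [n1 n2]].
  assert (e1 : q' o mB = mX o n).
  { apply (jointly_epic_product hE (in_either_comp (U:=pt) (V:=V)) hP cover).
    intros Z z [hz|hz].
    - destruct (hone Z) as [w _].
      rewrite <- !comp_assoc, (mB0 Z z w hz), (mX0 Z (n o z) w), comp_assoc, qpt; auto.
      now rewrite comp_assoc, n1.
    - rewrite <- !comp_assoc, (mB1 Z z hz), (mX1 Z (n o z)).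
      + now rewrite !comp_assoc, n2.
      + now rewrite comp_assoc, n1. }
  destruct (pair_exists hQ (idm (carrier X)) (idm (carrier X)))
    as [d [d1 d2]].
  assert (e2 : mX o d = idm _).
  { apply cover. intros Z z [hz|hz]; rewrite <- comp_assoc, comp_idl.
    - pose proof hz as [w hw]. rewrite (mX0 Z (d o z) w); [exact hw|].
      now rewrite comp_assoc, d1, comp_idl.
    - rewrite mX1; rewrite comp_assoc, ?d1, ?d2, comp_idl; auto. }
  assert (e3 : n o g = d o q').
  { apply (pair_unique hQ).
    - now rewrite !comp_assoc, n1, g1, d1, comp_idl.
    - now rewrite !comp_assoc, n2, d2, <- comp_assoc, g2, comp_idl, comp_idr. }
  now rewrite comp_assoc, e1, <- comp_assoc, e3, comp_assoc, e2, comp_idl. }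
(* The elements of the form [f(a)] lie over the base point of [X]. *)
assert (rf : is_zero_morphism (r o f)).
{ apply zero_morphism_factors. apply zero_morphism_factors in hqf.
  destruct hqf as [w hw]. exists w. symmetry. now apply (atpt _ w). }
destruct (huniv B r rf) as [s [hs _]].
exists s; split.
- apply (cokernel_epic hq). rewrite <- comp_assoc, hs, comp_idl.
  apply pointed_hom_eq. exact qr.
- intros s' hs'.
  (* [r(s'(x)) = mB(x, s'(x))], by cases on [x]. *)
  assert (rs : r o s' = s').
  { apply pointed_hom_eq. simpl.
    pose proof (f_equal (@proj1_sig _ _) hs') as e. simpl in e. fold q' in e.
    apply cover. intros Z z [[x hx]|hz].
    - simpl in hx. rewrite <- (comp_assoc (mB o g)), (atpt _ x).
      + rewrite <- hx, comp_assoc. f_equal. symmetry. exact (proj2_sig s').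
      + now rewrite comp_assoc, e, comp_idl.
    - rewrite <- !comp_assoc, mB1.
      + now rewrite !comp_assoc, g2, comp_idl.
      + now rewrite !comp_assoc, g1, e, comp_idl. }
  now rewrite <- rs, <- hs, <- comp_assoc, hs', comp_idr.
Qed.

End PointedObjects.

Theorem mainTheorem7 (E : category) (one : E) (hone : is_terminal one)
    (hE : elementary_topos E) (hB : boolean E) (X : pointed one) :
  is_initial_normal_cover (idm X).
Proof.
exists (id_normal_epi hone X).
intros [[B q] hq]. simpl in *.
destruct (normal_epi_unique_section hone hE hB hq) as [s [hs us]].
exists (exist _ s hs).
intros [s' hs']. apply slice_hom_eq. simpl. now apply us.
Qed.
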